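(* Let $\overline{M}/M$ be an extension over a complete idempotent semifield $\mathbb{K}\neq\{0,1\}$, and let $v : M \rightarrow \mathbb{K}$ be a linear form on $M$. Assume that the extension $\overline{M}/M$ is meet-continuous. Then $v$ is non-degenerate and continuous on $\overline{M}/M$ if and only if there is an archimedean element $c$ in $\overline{M}/M$ such that $v(x) = \langle c, x \rangle$ for all $x\in M$. In this case, the supremum of $\{x\in M : 1 \geqslant v(x)\}$ in $\overline{M}$ is the least such element $c$.
   Context: An idempotent semifield $\mathbb{K}$ is a semiring $(\mathbb{K},\oplus,\times,0,1)$, $1\ne 0$, with $\oplus$ idempotent ($t\oplus t=t$), in which every non-zero element has a multiplicative inverse. It is ordered by $s\leqslant t\iff s\oplus t=t$, so that $\oplus$ is the binary supremum and $0$ the least element. It is complete if every upper-bounded subset has a supremum. A $\mathbb{K}$-module is a commutative monoid $(M,\oplus,0)$ with a right action $(x,t)\mapsto x.t$ of $\mathbb{K}$ such that $x.0=0$, $x.1=x$, $x.(st)=(x.s).t$, $(x\oplus y).t=x.t\oplus y.t$, $x.(s\oplus t)=x.s\oplus x.t$; then $\oplus$ is idempotent on $M$ and $M$ is ordered by $x\leqslant y\iff x\oplus y=y$; $\bigoplus$ denotes supremum and $\wedge$ infimum. A submodule is a subset containing $0$ and closed under $\oplus$ and the action. A module $\overline{M}$ is complete if $x.\bigoplus T=\bigoplus_{t\in T}x.t$ for all $x\in \overline{M}$ and $T\subset\mathbb{K}$ with supremum, and every upper-bounded subset of $\overline{M}$ has a supremum. An extension $\overline{M}/M$ over $\mathbb{K}$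 is a pair where $\overline{M}$ is a complete $\mathbb{K}$-module and $M$ is a submodule of $\overline{M}$. All suprema of subsets of $M$ or $\overline{M}$ are taken in $\overline{M}$. An ideal of $M$ is a subset $I\subset M$ that is lower ($y\leqslant x\in I$, $y\in M$ imply $y\in I$) and closed under $\oplus$. The extension is meet-continuous if, for all $x\in M$ and all ideals $I$ of $M$ with an upper bound in $\overline{M}$, $x\wedge\bigoplus I=\bigoplus\{y\in I: y\leqslant x\}$ (computed in $\overline{M}$). A linear form on $M$ is a map $v:M\to\mathbb{K}$ with $v(x\oplus y)=v(x)\oplus v(y)$ and $v(x.t)=v(x)t$ for all $x,y\in M$, $t\in\mathbb{K}$. The map $v$ is non-degenerate on $\overline{M}/M$ if $\{x\in M:1\geqslant v(x)\}$ has an upper bound in $\overline{M}$. It is continuous on $\overline{M}/M$ if for every $X\subset M$ such that $\bigoplus X\in M$ (supremum taken in $\overline{M}$), $v(X)$ has a supremum in $\mathbb{K}$ and $v(\bigoplus X)=\bigoplus v(X)$. For $c\in\overline{M}$ and $x\in M$ let $F_c(x)=\{t\in\mathbb{K}:c.t\geqslant x\}$; $\langle c,x\rangle$ denotes the infimum of $F_c(x)$ in $\mathbb{K}$ if $F_c(x)\ne\emptyset$, and $\langle c,x\rangle=\top$ (an added greatest element) otherwise. An element $c\in\overline{M}$ is archimedean in $\overline{M}/M$ if for all $x\in M$: $F_c(x)\neq\emptyset$, and if the infimum of $F_c(x)$ is $0$ then $F_c(x)\supset\mathbb{K}\setminus\{0\}$. *)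

(* Defs.v *)
From HB Require Import structures.
From mathcomp Require Import all_boot all_algebra.
From mathcomp Require Import boolp classical_sets.

Set Implicit Arguments.
Unset Strict Implicit.
Unset Printing Implicit Defensive.

Import GRing.Theory.
Local Open Scope classical_set_scope.
Local Open Scope ring_scope.

(* The addition [+] plays the role of the idempotent operation.  Being defined
   on any commutative monoid, the order and the suprema and infima below serve
   both for the semifield and for its modules. *)
Section Order.
Variable V : nmodType.
Implicit Types (x y s : V) (A : set V).

Definition idem_le x y : Prop := x + y = y.

Definition is_ub A s : Prop := forall x, A x -> idem_le x s.
Definition is_lb A s : Prop := forall x, A x -> idem_le s x.

Definition is_sup A s : Prop :=
  is_ub A s /\ forall u, is_ub A u -> idem_le s u.
Definition is_inf A s : Prop :=
  is_lb A s /\ forall l, is_lb A l -> idem_le l s.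

Definition bounded_complete : Prop :=
  forall A, (exists u, is_ub A u) -> exists s, is_sup A s.

(* The default value 0 is only taken when [A] has no infimum. *)
Definition infimum A : V := xget 0 [set s | is_inf A s].

End Order.

(* Multiplication is not assumed to be commutative. *)
Definition idempotent_semifield (K : nzSemiRingType) : Prop :=
  (forall t : K, t + t = t) /\
  (forall t : K, t <> 0 -> exists s : K, s * t = 1 /\ t * s = 1).

Definition complete_idempotent_semifield (K : nzSemiRingType) : Prop :=
  idempotent_semifield K /\ bounded_complete K.

(* A right K-module is a left module over the converse semiring [K^c], so that
   [ract x (s * t) = ract (ract x s) t]. *)
Definition ract (K : nzSemiRingType) (V : lSemiModType K^c) (x : V) (t : K) : V :=
  (t : K^c) *: x.

Section Extension.
Variables (K : nzSemiRingType) (Mbar : lSemiModType K^c).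
Implicit Types (M I X : set Mbar) (x y c : Mbar) (s t : K).

Definition complete_module : Prop :=
  (forall x (T : set K) s, is_sup T s -> is_sup [set ract x t | t in T] (ract x s))
  /\ bounded_complete Mbar.

Definition submodule M : Prop :=
  [/\ M 0,
      forall x y, M x -> M y -> M (x + y) &
      forall x t, M x -> M (ract x t)].

Definition extension M : Prop := complete_module /\ submodule M.

Definition ideal M I : Prop :=
  [/\ I `<=` M,
      forall x y, I x -> M y -> idem_le y x -> I y &
      forall x y, I x -> I y -> I (x + y)].

Definition meet_continuous M : Prop :=
  forall x I, M x -> ideal M I -> (exists u, is_ub I u) ->
  exists s w : Mbar,
    [/\ is_sup I s, is_inf [set x; s] w &
        is_sup [set y | I y /\ idem_le y x] w].

(* A map M -> K is represented by a function on the whole of [Mbar], of which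
   only the values on [M] are ever used. *)
Definition linear_form M (v : Mbar -> K) : Prop :=
  (forall x y, M x -> M y -> v (x + y) = v x + v y) /\
  (forall x t, M x -> v (ract x t) = v x * t).

Definition nondegenerate_form M (v : Mbar -> K) : Prop :=
  exists u, is_ub [set x | M x /\ idem_le (v x) 1] u.

Definition continuous_form M (v : Mbar -> K) : Prop :=
  forall X (s : Mbar), X `<=` M -> is_sup X s -> M s -> is_sup [set v x | x in X] (v s).

Definition dominators c x : set K := [set t | idem_le x (ract c t)].

(* [None] is the added greatest element. *)
Definition bracket c x : option K :=
  if `[< dominators c x !=set0 >] then Some (infimum (dominators c x)) else None.

Definition archimedean_elt M c : Prop :=
  forall x, M x ->
    dominators c x !=set0 /\
    (is_inf (dominators c x) 0 -> forall t, t <> 0 -> dominators c x t).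

End Extension.

(* Main.v *)
(* Both conditions on [c] amount to the adjunction: [x <= c.t] if and only if
   [v x <= t], for [x] in [M] and all [t <> 0].  If [v] is non-degenerate and
   continuous, take for [c] the supremum of the ideal [{x in M : v x <= 1}];
   when [x <= c], meet-continuity exhibits [x] as the supremum of the elements
   of the ideal below [x], so that [v x <= 1] by continuity, and the general [t]
   follows by scaling.  Conversely the adjunction bounds [{x in M : v x <= 1}]
   by [c] and makes [v] preserve suprema; the value [0], where the adjunction is
   not available, is reached as the infimum of [K \ {0}], and this is where
   [K <> {0, 1}] is needed. *)
Require Import Defs.
From HB Require Import structures.
From mathcomp Require Import all_boot all_algebra.
From mathcomp Require Import boolp classical_sets.

Set Implicit Arguments.
Unset Strict Implicit.
Unset Printing Implicit Defensive.

Import GRing.Theory.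
Local Open Scope classical_set_scope.
Local Open Scope ring_scope.

(** * The order of an idempotent monoid *)

Section IdempotentOrder.
Variable V : nmodType.
Implicit Types (x y z : V) (A : set V).

Lemma idem_le_trans y x z : idem_le x y -> idem_le y z -> idem_le x z.
Proof. by rewrite /idem_le => xy yz; rewrite -yz addrA xy. Qed.

Lemma idem_le_anti x y : idem_le x y -> idem_le y x -> x = y.
Proof. by rewrite /idem_le => xy yx; rewrite -yx addrC. Qed.

Lemma idem_0le x : idem_le 0 x.
Proof. exact: add0r. Qed.

Lemma idem_le0 x : idem_le x 0 -> x = 0.
Proof. by rewrite /idem_le addr0. Qed.

Lemma idem_le_add x y z : idem_le x z -> idem_le y z -> idem_le (x + y) z.
Proof. by rewrite /idem_le => xz yz; rewrite -addrA yz. Qed.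

Lemma is_sup_unique A x y : is_sup A x -> is_sup A y -> x = y.
Proof.
by move=> [ubx lx] [uby ly]; apply: idem_le_anti; [apply: lx|apply: ly].
Qed.

Lemma is_inf_unique A x y : is_inf A x -> is_inf A y -> x = y.
Proof.
by move=> [lbx gx] [lby gy]; apply: idem_le_anti; [apply: gy|apply: gx].
Qed.

(** The infimum is obtained as the supremum of the lower bounds, a set that any element of [A]
    bounds above. *)
Lemma bounded_complete_inf A : bounded_complete V -> A !=set0 ->
  exists m, is_inf A m.
Proof.
move=> complV [a Aa].
have [|m [ubm leastm]] := complV [set l | is_lb A l].
  by exists a => l; apply.
exists m; split => [x Ax|l lbl]; last exact: ubm.
by apply: leastm => l; apply.
Qed.

Hypothesis addVV : forall x, x + x = x.

Lemma idem_le_refl x : idem_le x x.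
Proof. exact: addVV. Qed.

Lemma idem_le_addr x y : idem_le x (x + y).
Proof. by rewrite /idem_le addrA addVV. Qed.

Lemma idem_le_addl x y : idem_le x (y + x).
Proof. by rewrite addrC; exact: idem_le_addr. Qed.

End IdempotentOrder.

(** * Inversion and infima in an idempotent semifield *)

Section Semifield.
Variable K : nzSemiRingType.
Implicit Types (a b s t : K) (A : set K).

Lemma idem_le_mul2l a s t : idem_le s t -> idem_le (a * s) (a * t).
Proof. by rewrite /idem_le -mulrDr => ->. Qed.

Lemma idem_le_mul2r a s t : idem_le s t -> idem_le (s * a) (t * a).
Proof. by rewrite /idem_le -mulrDl => ->. Qed.

Lemma idem_le_inv a a' b b' :
  a' * a = 1 -> b * b' = 1 -> idem_le a b -> idem_le b' a'.
Proof.
move=> a'a bb' /(idem_le_mul2r b')/(idem_le_mul2l a').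
by rewrite bb' mulr1 mulrA a'a mul1r.
Qed.

Lemma inverse_neq0 s t : s * t = 1 -> s <> 0.
Proof. by move=> st s0; have := oner_neq0 K; rewrite -st s0 mul0r eqxx. Qed.

(** Inversion reverses the order on non-zero elements, so it carries an invertible infimum to a
    supremum. Every element of [A] is invertible because it lies above the non-zero [m]. *)
Lemma is_sup_inverses A m n : idempotent_semifield K ->
  A !=set0 -> is_inf A m -> n * m = 1 -> m * n = 1 ->
  is_sup [set i | exists2 t, A t & i * t = 1] n.
Proof.
move=> [_ inv] [a Aa] [lbm gtm] nm mn; split => [i [t At it]|u ubu].
  have tN0 : t <> 0.
    by move=> t0; apply: (inverse_neq0 mn); apply: idem_le0; rewrite -t0; exact: lbm.
  have [i' [_ ti']] := inv _ tN0.
  have -> : i = i' by rewrite -[LHS]mulr1 -ti' mulrA it mul1r.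
  exact: idem_le_inv nm ti' (lbm _ At).
have invA t : A t -> exists i, i * t = 1 /\ t * i = 1.
  move=> At; apply: inv => t0; apply: (inverse_neq0 mn).
  by apply: idem_le0; rewrite -t0; exact: lbm.
(* The bound [u] lies above the inverse of [a], hence is invertible; its inverse will be a lower
   bound of [A]. *)
have uN0 : u <> 0.
  have [i [ia _]] := invA _ Aa.
  move=> u0; apply: (inverse_neq0 ia); apply: idem_le0; rewrite -u0.
  by apply: ubu; exists a.
have [w [wu uw]] := inv _ uN0.
apply: (idem_le_inv uw mn); apply: gtm => t At.
have [i [it ti]] := invA _ At.
by apply: (idem_le_inv ti uw); apply: ubu; exists t.
Qed.

(** If the infimum [m] were invertible, cancelling it in [m <= m * a] would give [1 <= a] for every
    non-zero [a]; a third element of [K] rules this out. *)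
Lemma is_inf_nonzero : complete_idempotent_semifield K ->
  (exists t : K, t <> 0 /\ t <> 1) -> is_inf [set t : K | t <> 0] 0.
Proof.
move=> [[addKK inv] complK] [t [tN0 tN1]].
have [|m infm] := @bounded_complete_inf K [set t | t <> 0] complK.
  by exists t.
suff m0 : m = 0 by rewrite m0 in infm.
(* Take [t] or its inverse: if both were above 1, [t] would equal 1. *)
have [a aN0 a1] : exists2 a : K, a <> 0 & ~ idem_le 1 a.
  have [t1|Nt1] := pselect (idem_le 1 t); last by exists t.
  have [i [it ti]] := inv _ tN0.
  exists i; first exact: inverse_neq0 it.
  move=> i1; apply: tN1; apply: idem_le_anti t1.
  by have := idem_le_mul2r t i1; rewrite it mul1r.
apply: contrapT => mN0; have [i [im mi]] := inv _ mN0.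
have [b [ba ab]] := inv _ aN0.
have maN0 : m * a <> 0.
  by apply: (@inverse_neq0 _ (b * i)); rewrite mulrA -(mulrA m) ab mulr1.
apply: a1; have := idem_le_mul2l i (infm.1 _ maN0).
by rewrite mulrA im mul1r.
Qed.

End Semifield.

(** * Dominators and the bracket in a module *)

Section Module.
Variables (K : nzSemiRingType) (V : lSemiModType K^c).
Implicit Types (x y c : V) (s t : K).

Lemma ractM x s t : ract x (s * t) = ract (ract x s) t.
Proof. by rewrite /ract scalerA. Qed.

Lemma ract1 x : ract x 1 = x.
Proof. exact: scale1r. Qed.

Lemma ract0 x : ract x 0 = 0.
Proof. exact: scale0r. Qed.

Lemma ract_addl x y t : ract (x + y) t = ract x t + ract y t.
Proof. exact: scalerDr. Qed.

Lemma ract_addr x s t : ract x (s + t) = ract x s + ract x t.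
Proof. exact: scalerDl. Qed.

Lemma module_addxx : (forall t, t + t = t) -> forall x, x + x = x.
Proof. by move=> addKK x; rewrite -[x in LHS]ract1 -ract_addr addKK ract1. Qed.

Lemma idem_le_ract2l x s t : idem_le s t -> idem_le (ract x s) (ract x t).
Proof. by rewrite /idem_le -ract_addr => ->. Qed.

Lemma idem_le_ract2r t x y : idem_le x y -> idem_le (ract x t) (ract y t).
Proof. by rewrite /idem_le -ract_addl => ->. Qed.

Lemma ract_le_inv x c i t : t * i = 1 -> i * t = 1 ->
  idem_le (ract x i) c <-> idem_le x (ract c t).
Proof.
move=> ti it; split.
  by move=> /(idem_le_ract2r t); rewrite -ractM it ract1.
by move=> /(idem_le_ract2r i); rewrite -ractM ti ract1.
Qed.

(** The action of a complete module preserves suprema of scalars, so the infimum [m] is handled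
    through inverses: [x.i <= c] for the inverse [i] of each dominator, and the supremum of these
    [i] is the inverse of [m]. *)
Lemma infimum_dominates c x m : idempotent_semifield K -> complete_module V ->
  dominators c x !=set0 -> is_inf (dominators c x) m -> m <> 0 ->
  dominators c x m.
Proof.
move=> semiK [ractsup _] domN0 infm mN0; have [n [nm mn]] := semiK.2 _ mN0.
apply/(ract_le_inv _ _ mn nm).
have supn := is_sup_inverses semiK domN0 infm nm mn.
apply: (ractsup x _ _ supn).2 => _ [i [t domt it] <-].
have tN0 : t <> 0.
  by move=> t0; apply: mN0; apply: idem_le0; rewrite -t0; exact: infm.1.
have [i' [i't ti']] := semiK.2 _ tN0.
have -> : i = i' by rewrite -[LHS]mulr1 -ti' mulrA it mul1r.
exact/(ract_le_inv _ _ ti' i't).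
Qed.

(** Completeness provides the infimum of a non-empty set of dominators, so the default value of
    [infimum] never interferes. *)
Lemma bracket_SomeP c x t : bounded_complete K ->
  Some t = bracket c x <-> dominators c x !=set0 /\ is_inf (dominators c x) t.
Proof.
rewrite /bracket => complK; case: asboolP => domN0; last by split=> // -[].
have [m infm] := bounded_complete_inf complK domN0.
have inf_infimum : is_inf (dominators c x) (Defs.infimum (dominators c x)).
  exact: (xgetPex 0 (ex_intro (is_inf (dominators c x)) m infm)).
split=> [[->]|[_ inft]]; first by [].
by congr Some; exact: is_inf_unique inft inf_infimum.
Qed.

End Module.

(** * Representing elements and the adjunction *)

Section Representation.
Variables (K : nzSemiRingType) (Mbar : lSemiModType K^c).
Variables (M : set Mbar) (v : Mbar -> K).
Hypothesis hK : complete_idempotent_semifield K.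
Hypothesis hK01 : exists t : K, t <> 0 /\ t <> 1.
Hypothesis hM : extension M.
Hypothesis hv : linear_form M v.

Let addKK : forall t : K, t + t = t := hK.1.1.
Let addMM : forall x : Mbar, x + x = x := module_addxx addKK.

Definition represents (c : Mbar) : Prop :=
  archimedean_elt M c /\ forall x : Mbar, M x -> Some (v x) = bracket c x.

(** At [t = 0] the equivalence would force [v] to vanish only at 0, which is not assumed. *)
Definition adjoint (c : Mbar) : Prop :=
  forall x t, M x -> t <> 0 -> idem_le x (ract c t) <-> idem_le (v x) t.

Lemma linear_form0 : v 0 = 0.
Proof. by rewrite -(ract0 0) hv.2 ?mulr0 //; case: hM.2. Qed.

Lemma linear_form_mono x y : M x -> M y -> idem_le x y -> idem_le (v x) (v y).
Proof. by move=> Mx My; rewrite /idem_le => xy; rewrite -hv.1 // xy. Qed.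

Lemma represents_adjoint c : represents c <-> adjoint c.
Proof.
split=> [[arch vE] x t Mx tN0|adj].
  have /bracket_SomeP[|domN0 infv] := vE _ Mx; first exact: hK.2.
  split=> [|vt]; first exact: infv.1.
  (* If [v x = 0], the archimedean condition makes every non-zero [t] a dominator; otherwise the
     infimum [v x] is itself a dominator. *)
  have [v0|vN0] := pselect (v x = 0); first by apply: (arch _ Mx).2 => //; rewrite -v0.
  apply: idem_le_trans (idem_le_ract2l c vt).
  exact: infimum_dominates hK.1 hM.1 domN0 infv vN0.
have dom0 x t : M x -> v x = 0 -> t <> 0 -> dominators c x t.
  by move=> Mx v0 tN0; apply/adj => //; rewrite v0; exact: idem_0le.
have domN0 x : M x -> dominators c x !=set0.
  (* Adding 1 yields a non-zero scalar above [v x], to which the adjunction applies. *)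
  move=> Mx; exists (v x + 1); apply/adj => //; last exact: idem_le_addr.
  move=> v10; have := oner_neq0 K; suff -> : 1 = 0 :> K by rewrite eqxx.
  by apply: idem_le0; rewrite -v10; exact: idem_le_addl.
have infv x : M x -> is_inf (dominators c x) (v x).
  move=> Mx; split=> [t domt|l lbl].
    have [t0|tN0] := pselect (t = 0); last exact/adj.
    have x0 : x = 0 by apply: idem_le0; rewrite -(ract0 c) -t0.
    by rewrite x0 linear_form0; exact: idem_0le.
  (* A non-zero [v x] is a dominator. If [v x = 0], all non-zero scalars are dominators, so [l] lies
     below their infimum 0. *)
  have [v0|vN0] := pselect (v x = 0).
    rewrite v0; apply: (is_inf_nonzero hK hK01).2 => t tN0.
    by apply: lbl; exact: dom0.
  by apply: lbl; apply/adj => //; exact: idem_le_refl.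
split=> x Mx; last by apply/bracket_SomeP; [exact: hK.2|split; auto].
split=> [|inf0 t]; first exact: domN0.
by apply: dom0 => //; exact: is_inf_unique (infv _ Mx) inf0.
Qed.

Lemma adjoint_ub c : adjoint c -> is_ub [set x | M x /\ idem_le (v x) 1] c.
Proof.
move=> adj x [Mx v1]; rewrite -(ract1 c); apply/adj => //.
by move=> /eqP; rewrite oner_eq0.
Qed.

Lemma adjoint_continuous c : adjoint c -> continuous_form M v.
Proof.
move=> adj X s XM sups Ms; split=> [_ [x Xx <-]|u ubu].
  by apply: linear_form_mono => //; [exact: XM|exact: sups.1].
(* The usual argument that a left adjoint preserves suprema, run at a non-zero [t] above [u] since
   [u] itself may be 0. *)
have le_ub t : t <> 0 -> idem_le u t -> idem_le (v s) t.
  move=> tN0 ut; apply/adj => //; apply: sups.2 => x Xx.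
  apply/adj => //; first exact: XM.
  by apply: idem_le_trans ut; apply: ubu; exists x.
have [u0|uN0] := pselect (u = 0); last by apply: le_ub => //; exact: idem_le_refl.
rewrite u0; apply: (is_inf_nonzero hK hK01).2 => t tN0.
by apply: le_ub => //; rewrite u0; exact: idem_0le.
Qed.

Lemma unit_ball_ideal : ideal M [set x | M x /\ idem_le (v x) 1].
Proof.
split=> [x []//|x y [Mx vx] My yx|x y [Mx vx] [My vy]].
  by split=> //; apply: idem_le_trans vx; exact: linear_form_mono.
split; first by case: hM.2 => _ + _; apply.
by rewrite hv.1 //; exact: idem_le_add.
Qed.

Lemma unit_ball_sup_adjoint c : meet_continuous M -> continuous_form M v ->
  is_sup [set x | M x /\ idem_le (v x) 1] c -> adjoint c.
Proof.
move=> hmc contv supc x t Mx tN0; have [i [it ti]] := hK.1.2 _ tN0.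
(* Replacing [x] by [x.i], with [i] the inverse of [t], reduces the claim to [t = 1]. *)
suff le_c y : M y -> idem_le y c <-> idem_le (v y) 1.
  rewrite -(ract_le_inv _ _ ti it) le_c; last by case: hM.2 => _ _; apply.
  rewrite hv.2 //; split.
    by move=> /(idem_le_mul2r t); rewrite -mulrA it mulr1 mul1r.
  by move=> /(idem_le_mul2r i); rewrite ti.
move=> My; split=> [yc|vy]; last exact: supc.1.
have [|s [w [sups infw supw]]] := hmc y _ My unit_ball_ideal.
  by exists c; exact: supc.1.
rewrite (is_sup_unique sups supc) in infw.
(* Since [y <= c], the meet of [y] and [c] is [y], which is thus the supremum of the ball elements
   below it. *)
have yw : y = w.
  apply: is_inf_unique infw; split=> [_ [->|->]//|l]; last by apply; left.
  exact: idem_le_refl.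
rewrite -yw in supw.
have [|_] := contv _ _ _ supw My; first by move=> z [[]].
by apply=> _ [z [[_ vz] _] <-].
Qed.

End Representation.

Theorem theorem1p2 (K : nzSemiRingType) (Mbar : lSemiModType K^c)
    (M : set Mbar) (v : Mbar -> K)
    (hK : complete_idempotent_semifield K)
    (hK01 : exists t : K, t <> 0 /\ t <> 1)
    (hM : extension M)
    (hv : linear_form M v)
    (hmc : meet_continuous M) :
  ((nondegenerate_form M v /\ continuous_form M v) <->
     (exists c : Mbar, archimedean_elt M c /\
        forall x : Mbar, M x -> Some (v x) = bracket c x)) /\
  ((nondegenerate_form M v /\ continuous_form M v) ->
     exists s : Mbar,
       [/\ is_sup [set x | M x /\ idem_le (v x) 1] s,
           archimedean_elt M s /\
             (forall x : Mbar, M x -> Some (v x) = bracket s x) &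
           forall c : Mbar, archimedean_elt M c ->
             (forall x : Mbar, M x -> Some (v x) = bracket c x) ->
             idem_le s c]).
Proof.
have forward : nondegenerate_form M v /\ continuous_form M v ->
    exists2 s, is_sup [set x | M x /\ idem_le (v x) 1] s & represents M v s.
  move=> [nondeg contv]; have [s sups] := hM.1.2 _ nondeg.
  exists s => //; apply/(represents_adjoint hK hK01 hM hv).
  exact: unit_ball_sup_adjoint contv sups.
split.
  split=> [/forward[s _ reps]|[c /(represents_adjoint hK hK01 hM hv) adj]].
    by exists s.
  by split; [exists c; exact: adjoint_ub|exact: adjoint_continuous adj].
(* Leastness holds because every representing [c] is an upper bound of the unit ball, of which [s]
   is the supremum. *)
move=> /forward[s sups reps]; exists s; split=> // c archc vE.
apply: sups.2; apply: adjoint_ub.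
by apply/(represents_adjoint hK hK01 hM hv); split.
Qed.
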